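(* Let $m\geq 3$ and $n\in \mathbb{N}=\{1,2,\dots\}$. Then \[ p'_{m}(n)=\sum_{k=1}^\infty (-1)^{k+1} \big(p'_{m}(n- P_{m+2,k})+p'_m(n-Q_{m+2,k})\big), \] where $P_{m+2,k}=\frac{k(mk-(m-2))}{2}$ and $Q_{m+2,k}=\frac{k(mk+(m-2))}{2}$.
   Context: For an integer $m\ge 3$, $p'_m(n)$ is the number of partitions of $n$ in which every part is congruent to $0$, $1$ or $m-1$ modulo $m$; equivalently $\sum_{n\ge0}p'_m(n)q^n=\frac{1}{(q;q^m)_\infty(q^{m-1};q^m)_\infty(q^m;q^m)_\infty}$, where $(a;q)_\infty=\prod_{k\ge0}(1-aq^k)$. By convention $p'_m(0)=1$ and $p'_m(x)=0$ for $x\notin\mathbb{N}_0$. (For $m=3$, $p'_3=p$ is the ordinary partition function.) *)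

(* Defs.v *)
From HB Require Import structures.
From mathcomp Require Import all_boot all_order all_algebra.
Set Implicit Arguments. Unset Strict Implicit. Unset Printing Implicit Defensive.
Import Order.TTheory GRing.Theory Num.Theory.

Definition is_partm (m n : nat) (s : seq nat) : bool :=
  [&& sorted geq s, all (fun x => 0 < x) s,
      all (fun x => (x %% m == 0) || (x %% m == 1) || (x %% m == (m - 1) %% m)) s
    & sumn s == n].

(* p'_m(n): number of such partitions. Every partition of n has at most n
   parts, each at most n, so it is the map (val) of a unique k.-tuple over
   'I_n.+1 for a unique k <= n. *)
Definition pprime_nat (m n : nat) : nat :=
  \sum_(k < n.+1) #|[pred t : k.-tuple 'I_n.+1 | is_partm m n (map val t)]|.

Definition pprime (m : nat) (x : int) : nat :=
  match x with Posz n => pprime_nat m n | Negz _ => 0%N end.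

(* pentagonal-type numbers P_{m+2,k} and Q_{m+2,k} (always integers) *)
Definition Pnum (m k : nat) : nat := (k * (m * k - (m - 2))) %/ 2.
Definition Qnum (m k : nat) : nat := (k * (m * k + (m - 2))) %/ 2.

(* Main.v *)
(* Up to degree n, the generating function G of the partitions with parts
   0, +-1 mod m is the inverse of the product of the (1 - X^a) over the allowed
   a.  With Q = X^m, z = X, the Jacobi triple product identity turns this
   product into the sum over all integers k of (-1)^k X^(k(mk-(m-2))/2), whose
   exponents are the P_k and Q_k, and the recurrence is the coefficient of X^n
   in G times this series.  The triple product is obtained, up to degree n, from
   its finite form
     prod_(j < N) (1 - z Q^j)(1 - z^-1 Q^(j+1))
       = sum_(-N <= k <= N) (-1)^k z^k Q^(k(k-1)/2) [2N choose N+k]_Q,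
   since [2N choose N+k]_Q * prod_(i <= N) (1 - Q^i) is 1 up to a degree that
   grows with N - |k|. *)
Require Import Defs.
From HB Require Import structures.
From mathcomp Require Import all_boot all_order all_algebra.
From mathcomp Require Import zify ring.
Set Implicit Arguments. Unset Strict Implicit.
Unset Printing Implicit Defensive.
Import Order.TTheory GRing.Theory Num.Theory.
Local Open Scope ring_scope.

(** * Partitions with parts in a set [A] *)

Definition is_part (A : pred nat) (n : nat) (s : seq nat) : bool :=
  [&& sorted geq s, all (fun x => 0 < x)%N s, all A s & sumn s == n].

Definition part_count (A : pred nat) (n : nat) : nat :=
  (\sum_(k < n.+1) #|[pred t : k.-tuple 'I_n.+1 | is_part A n (map val t)]|)%N.

Lemma mem_leq_sumn (s : seq nat) (x : nat) : x \in s -> (x <= sumn s)%N.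
Proof.
elim: s => //= y s IHs; rewrite inE => /orP[/eqP->|/IHs]; first exact: leq_addr.
by move/leq_trans; apply; apply: leq_addl.
Qed.

Lemma size_leq_sumn (s : seq nat) :
  all (fun x => 0 < x)%N s -> (size s <= sumn s)%N.
Proof. by elim: s => //= x s IHs /andP[x0 /IHs]; lia. Qed.

(** A duplicate-free list replaces the bounded tuples, so that two counts can be compared through
    membership alone. *)
Lemma part_enum (A : pred nat) (n : nat) :
  {L : seq (seq nat) | [/\ uniq L, size L = part_count A n
                         & forall s, (s \in L) = is_part A n s]}.
Proof.
pose T k := [seq map val (tval t) | t <- enum [pred t : k.-tuple 'I_n.+1 |
                                        is_part A n (map val t)]].
have memT k s : (s \in T k) = (size s == k) && is_part A n s.
  apply/mapP/andP => [[t]|[/eqP sz Ps]].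
    by rewrite mem_enum inE => Pt ->; rewrite size_map size_tuple.
  have le_s x : x \in s -> (x < n.+1)%N.
    by case/and4P: Ps => _ _ _ /eqP <- /mem_leq_sumn.
  have sz' : size [seq inord x : 'I_n.+1 | x <- s] == k by rewrite size_map sz.
  have def_s : s = map val (Tuple sz').
    rewrite -map_comp -[LHS]map_id; apply/eq_in_map => x xs /=.
    by rewrite inordK ?le_s.
  by exists (Tuple sz'); rewrite ?mem_enum ?inE -?def_s.
exists (flatten [seq T k | k <- iota 0 n.+1]); split.
- have: uniq (iota 0 n.+1) by apply: iota_uniq.
  elim: (iota 0 n.+1) => //= k r IHr /andP[kr /IHr ur].
  rewrite cat_uniq ur andbT; apply/andP; split.
    rewrite map_inj_uniq ?enum_uniq // => t1 t2 /(inj_map val_inj) eq_t.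
    exact: val_inj.
  apply/hasPn => s /flatten_mapP[k' k'r]; rewrite memT => /andP[/eqP sz _].
  by rewrite memT sz; apply: contra kr => /andP[/eqP <-].
- rewrite size_flatten /shape -map_comp sumnE big_map /part_count.
  rewrite -(big_mkord xpredT (fun k =>
    #|[pred t : k.-tuple 'I_n.+1 | is_part A n (map val t)]|)).
  rewrite /index_iota subn0; apply: eq_bigr => k _ /=.
  by rewrite size_map -cardE.
move=> s; apply/flatten_mapP/idP => [[k _]|Ps]; last first.
  exists (size s); last by rewrite memT eqxx.
  rewrite mem_iota /= ltnS; case/and4P: Ps => _ s0 _ /eqP <-.
  exact: size_leq_sumn.
by rewrite memT => /andP[].
Qed.

Lemma part_count_size (A : pred nat) (n : nat) (L : seq (seq nat)) :
  uniq L -> (forall s, (s \in L) = is_part A n s) -> size L = part_count A n.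
Proof.
move=> uL memL; have [L' [uL' <- memL']] := part_enum A n.
by apply/perm_size/uniq_perm => // s; rewrite memL memL'.
Qed.

Lemma eq_part_count (A B : pred nat) (n : nat) :
  (forall x, (0 < x <= n)%N -> A x = B x) -> part_count A n = part_count B n.
Proof.
move=> eqAB; have [L [uL <- memL]] := part_enum A n.
apply: part_count_size uL _ => s; rewrite memL /is_part.
case: (sorted _ _) => //=; case: (boolP (all _ s)) => //= /allP s0.
case: eqP => [sn|]; rewrite ?andbF // !andbT.
by apply: eq_in_all => x xs; apply: eqAB; rewrite s0 //= -sn mem_leq_sumn.
Qed.

Lemma part_count_pred0 (n : nat) : part_count pred0 n = (n == 0)%N.
Proof.
rewrite -(@part_count_size _ _ (nseq (n == 0)%N [::])) ?size_nseq //.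
  by case: (n == 0)%N.
move=> [|x s]; first by rewrite /is_part /= mem_nseq eq_sym eqxx andbT lt0b.
by rewrite mem_nseq /is_part /= !andbF.
Qed.

(* The largest allowed part [b] either does not occur, or is the head of the
   partition. *)
Lemma part_countS (A : pred nat) (b n : nat) :
  (0 < b)%N -> A b -> (forall x, A x -> x <= b)%N ->
  part_count A n =
    (part_count (fun x => A x && (x != b)) n
     + (if b <= n then part_count A (n - b) else 0))%N.
Proof.
move=> b0 Ab maxb; set A' := fun x => _.
have [L1 [uL1 <- memL1]] := part_enum A' n.
have [L2 [uL2 <- memL2]] := part_enum A (n - b).
pose L3 := if (b <= n)%N then map (cons b) L2 else [::].
have -> : (if (b <= n)%N then size L2 else 0%N) = size L3.
  by rewrite /L3; case: ifP; rewrite ?size_map.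
rewrite -size_cat; symmetry.
have memL3 s : (s \in L3) = is_part A n s && (b \in s).
  case: (boolP (b \in s)) => bs; last first.
    rewrite andbF /L3; case: ifP => // _.
    by apply/negbTE/mapP => -[t _ def_s]; rewrite def_s inE eqxx in bs.
  rewrite andbT; case: s bs => // x s; rewrite inE => bs.
  apply/idP/idP => [|Ps].
    rewrite /L3; case: ifP => // le_bn /mapP[t]; rewrite memL2.
    case/and4P=> st t0 tA /eqP sumt [-> ->].
    rewrite /is_part /= b0 t0 Ab tA sumt subnKC // eqxx !andbT.
    rewrite path_min_sorted //; apply/allP => y /(allP tA)/maxb; exact.
  case/and4P: Ps => /= ss /andP[x0 s0] /andP[Ax As] /eqP sums.
  have def_x : x = b.
    case/orP: bs => [/eqP //|bs]; apply/eqP; rewrite eqn_leq maxb //=.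
    have tr : transitive geq by move=> y z t /= h1 h2; apply: leq_trans h2 h1.
    exact: (allP (order_path_min tr ss)).
  rewrite def_x in ss sums *; rewrite /L3 ifT; last by rewrite -sums leq_addr.
  apply/mapP; exists s => //; rewrite memL2 /is_part (path_sorted ss) s0 As.
  by rewrite -sums addKn eqxx.
have memL1' s : (s \in L1) = is_part A n s && (b \notin s).
  rewrite memL1 /is_part /A' all_predI [all (fun x => x != b) s]all_predC.
  by rewrite has_pred1; case: (b \in s); rewrite ?andbF ?andbT.
apply: part_count_size => [|s]; last first.
  by rewrite mem_cat memL1' memL3; case: (is_part _ _ _); case: (b \in s).
rewrite cat_uniq uL1 /=; apply/andP; split.
  by apply/hasPn => s; rewrite memL3 => /andP[_ bs]; rewrite memL1' bs andbF.
by rewrite /L3; case: ifP => // _; rewrite map_inj_uniq // => ? ? [].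
Qed.

(** * Congruence of polynomials modulo X^n, in place of power series *)

Definition eq_upto {R : nzRingType} (n : nat) (p q : {poly R}) : Prop :=
  forall i, (i < n)%N -> p`_i = q`_i.

Section EqUpto.
Variables (R : comNzRingType) (n : nat).
Implicit Types p q r : {poly R}.

Lemma eq_upto_sym p q : eq_upto n p q -> eq_upto n q p.
Proof. by move=> pq i /pq. Qed.

Lemma eq_upto_trans p q r : eq_upto n p q -> eq_upto n q r -> eq_upto n p r.
Proof. by move=> pq qr i lt_i; rewrite pq ?qr. Qed.

Lemma eq_upto_mul p p' q q' :
  eq_upto n p p' -> eq_upto n q q' -> eq_upto n (p * q) (p' * q').
Proof.
move=> pp qq i lt_i; rewrite !coefM; apply: eq_bigr => -[j /= lt_j] _.
by rewrite pp ?qq //; lia.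
Qed.

Lemma eq_upto_sum (I : Type) (r : seq I) (F G : I -> {poly R}) :
  (forall i, eq_upto n (F i) (G i)) ->
  eq_upto n (\sum_(i <- r) F i) (\sum_(i <- r) G i).
Proof.
by move=> FG i lt_i; rewrite !coef_sum; apply: eq_bigr => j _; apply: FG.
Qed.

(** If [e >= n], both sides vanish below degree [n], so nothing is asked of [p]. This disposes of
    the q-binomials far from the centre of the Jacobi sum. *)
Lemma eq_upto_XnM e p :
  ((e < n)%N -> eq_upto n p 1) -> eq_upto n ('X^e * p) 'X^e.
Proof.
move=> p1 i lt_i; rewrite -['X^e in RHS]mulr1 !coefXnM.
by case: ltnP => // le_ei; rewrite p1 //; lia.
Qed.

End EqUpto.

(** * Generating functions of partitions *)

Definition part_gf (n : nat) (A : pred nat) : {poly int} :=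
  \poly_(i < n) (part_count A i)%:R.

Lemma part_gf_factor (n b : nat) (A : pred nat) :
  (0 < b)%N -> A b -> (forall x, A x -> x <= b)%N ->
  eq_upto n ((1 - 'X^b) * part_gf n A)
            (part_gf n (fun x => A x && (x != b))).
Proof.
move=> b0 Ab maxb i lt_i; rewrite mulrBl mul1r coefB coefXnM !coef_poly lt_i.
rewrite (@part_countS A b i) // natrD; case: ltnP => [|le_bi].
  by rewrite subr0 addr0.
by rewrite ifT ?addrK //; lia.
Qed.

Lemma eq_part_gf (n : nat) (A B : pred nat) :
  (forall x, (0 < x)%N -> A x = B x) -> part_gf n A = part_gf n B.
Proof.
move=> eqAB; apply/polyP => i; rewrite !coef_poly; case: ifP => // _.
by congr _%:R; apply: eq_part_count => x /andP[x0 _]; apply: eqAB.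
Qed.

(** Induction on [B]: by [part_gf_factor], the factor for [B.+1], if this part is allowed, removes
    it from the generating function. *)
Lemma part_gf_inv (A : pred nat) (n B : nat) :
  eq_upto n ((\prod_(0 <= a < B | A a.+1) (1 - 'X^(a.+1) : {poly int}))
             * part_gf n (fun x => A x && (0 < x <= B)%N)) 1.
Proof.
elim: B => [|B IHB].
  rewrite big_nil mul1r => i lt_i; rewrite coef_poly lt_i.
  rewrite (@eq_part_count _ pred0) ?part_count_pred0 ?coef1 //.
  by move=> x _; case: x => [|x]; rewrite ?andbF.
rewrite big_mkcond big_nat_recr // -big_mkcond /=.
case: (boolP (A B.+1)) => AB; last first.
  rewrite mulr1 (@eq_part_gf n _ (fun x => A x && (0 < x <= B)%N)) // => x x0.
  case: (eqVneq x B.+1) AB => [->|nx] AB; first by rewrite (negbTE AB).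
  by congr (_ && _); lia.
rewrite -mulrA; apply: eq_upto_trans IHB; apply: eq_upto_mul => //.
apply: eq_upto_trans (@part_gf_factor n B.+1 _ _ _ _) _ => //.
- by rewrite AB leqnn.
- by move=> x /andP[_ /andP[]].
rewrite (@eq_part_gf n _ (fun x => A x && (0 < x <= B)%N)) // => x x0.
by rewrite -andbA; congr (_ && _); lia.
Qed.

(** * Gaussian binomial coefficients *)

Section QBinomial.
Variables (R : comNzRingType) (q : R).

(** A q-Pascal rule serves as definition, which avoids division in [R]. *)
Fixpoint qbinom (n r : nat) : R :=
  match n, r with
  | _, 0 => 1
  | 0, _.+1 => 0
  | n'.+1, r'.+1 => qbinom n' r' + q ^+ r * qbinom n' r
  end.

Definition qfact (n : nat) : R := \prod_(0 <= i < n) (1 - q ^+ i.+1).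

Lemma qbinom0 n : qbinom n 0 = 1. Proof. by case: n. Qed.

Lemma qbinomS n r :
  qbinom n.+1 r.+1 = qbinom n r + q ^+ r.+1 * qbinom n r.+1.
Proof. by []. Qed.

Lemma qbinom_small n r : (n < r)%N -> qbinom n r = 0.
Proof.
elim: n r => [|n IHn] [|r] //; rewrite ltnS => lt_nr.
by rewrite qbinomS !IHn ?mulr0 ?addr0 // ltnW.
Qed.

(** The other q-Pascal rule: it raises [a] in [jacobi_sum a b], while [qbinomS] raises [b]. *)
Lemma qbinomSr n r : (r <= n)%N ->
  qbinom n.+1 r.+1 = qbinom n r.+1 + q ^+ (n - r) * qbinom n r.
Proof.
elim: n r => [|n IHn] [|r] // le_rn.
- by rewrite /= expr0 mulr0 addr0 mulr1 add0r.
- rewrite qbinomS [in LHS]IHn // [in RHS]qbinomS !qbinom0 !subn0.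
  by rewrite [q ^+ n.+1]exprS; ring.
have [lt_rn|ge_rn] := ltnP r n; last first.
  have -> : r = n by lia.
  by rewrite subnn [LHS]qbinomS (@qbinom_small n.+1 n.+2) //; ring.
rewrite [LHS]qbinomS [in LHS]IHn // [in LHS]IHn //.
rewrite [qbinom n.+1 r.+2]qbinomS [qbinom n.+1 r.+1]qbinomS subSS.
have E : q ^+ (n - r) * q ^+ r.+1 = q ^+ r.+2 * q ^+ (n - r.+1).
  by rewrite -!exprD; congr (_ ^+ _); lia.
by rewrite [in RHS]mulrDr [_ * (q ^+ r.+1 * _)]mulrA E; ring.
Qed.

Lemma qfactS n : qfact n.+1 = qfact n * (1 - q ^+ n.+1).
Proof. by rewrite /qfact big_nat_recr. Qed.

Lemma qbinom_fact n r : (r <= n)%N ->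
  qbinom n r * qfact r * qfact (n - r) = qfact n.
Proof.
have qfact0 : qfact 0 = 1 by rewrite /qfact big_nil.
elim: n r => [|n IHn] [|r] le_rn; rewrite ?qbinom0 ?subn0 ?qfact0 ?mul1r //.
rewrite subSS qbinomS qfactS mulrDl mulrDl !mulrA.
have -> : qbinom n r * qfact r * (1 - q ^+ r.+1) * qfact (n - r)
          = qfact n * (1 - q ^+ r.+1) by rewrite -(IHn r) //; ring.
have [lt_rn|ge_rn] := ltnP r n; last first.
  have -> : r = n by lia.
  by rewrite (@qbinom_small n n.+1) // qfactS; ring.
have -> : (n - r = (n - r.+1).+1)%N by lia.
rewrite [qfact n.+1]qfactS [qfact (_ - _).+1]qfactS.
have := IHn _ lt_rn; rewrite qfactS => <-.
have -> : q ^+ n.+1 = q ^+ r.+1 * q ^+ (n - r.+1).+1.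
  by rewrite -exprD; congr (_ ^+ _); lia.
ring.
Qed.

End QBinomial.

(* [jacobi_exp m r b] is k(mk-(m-2))/2 for the possibly negative k = r - b. *)
Definition jacobi_exp (m r b : nat) : nat :=
  if (b <= r)%N then Pnum m (r - b) else Qnum m (b - r).

(** * The finite Jacobi triple product *)

Section FiniteJacobi.
Variable m : nat.
Hypothesis m_gt1 : (1 < m)%N.

Lemma Pnum0 : Pnum m 0 = 0%N. Proof. by rewrite /Pnum. Qed.

Lemma Qnum0 : Qnum m 0 = 0%N. Proof. by rewrite /Qnum. Qed.

Lemma PnumS k : Pnum m k.+1 = (Pnum m k + (m * k + 1))%N.
Proof.
(* The numerators differ by exactly twice the increment, so the quotients compare without a parity
   argument. *)
rewrite /Pnum [RHS]addnC -divnMDl //; congr (_ %/ 2)%N.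
(* At [k = 0] the subtraction in [Pnum] is truncated. *)
case: k => [|k]; first by lia.
have := leq_pmulr m (ltn0Sn k); nia.
Qed.

Lemma QnumS k : Qnum m k.+1 = (Qnum m k + (m * k + (m - 1)))%N.
Proof. rewrite /Qnum [RHS]addnC -divnMDl //; congr (_ %/ 2)%N; nia. Qed.

Lemma Pnum_ge k : (k <= Pnum m k)%N.
Proof. by elim: k => // k IHk; rewrite PnumS; lia. Qed.

Lemma Qnum_ge k : (k <= Qnum m k)%N.
Proof. by elim: k => // k IHk; rewrite QnumS; lia. Qed.

Lemma jacobi_exp_ge r b : (maxn (r - b) (b - r) <= jacobi_exp m r b)%N.
Proof.
rewrite /jacobi_exp; case: (leqP b r) => le_br.
  by have := Pnum_ge (r - b); lia.
by have := Qnum_ge (b - r); lia.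
Qed.

Lemma jacobi_expSS r b : jacobi_exp m r.+1 b.+1 = jacobi_exp m r b.
Proof. by rewrite /jacobi_exp ltnS !subSS. Qed.

(** From k = r - b to k + 1 the exponent changes by mk + 1, possibly negative. Writing it with [c]
    stays in [nat] and, for c = a, produces the power Q^(a+b-r) of [qbinomSr]. *)
Lemma jacobi_expS r b c : (r <= b + c)%N ->
  (jacobi_exp m r b + (m * c + 1) = jacobi_exp m r.+1 b + m * (b + c - r))%N.
Proof.
move=> le_r; rewrite /jacobi_exp; case: (leqP b r) => br.
  by rewrite leqW // subSn // PnumS; nia.
(* Here k = -1 moves to k = 0, crossing from [Qnum] to [Pnum]. *)
case: (leqP b r.+1) => br1.
  have -> : (b - r = 1)%N by lia.
  have -> : (r.+1 - b = 0)%N by lia.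
  by rewrite QnumS Qnum0 Pnum0; nia.
have -> : (b - r = (b - r.+1).+1)%N by lia.
rewrite QnumS; nia.
Qed.

Lemma jacobi_expSr r b :
  (jacobi_exp m r b + (m * b + (m - 1)) = jacobi_exp m r b.+1 + m * r)%N.
Proof.
rewrite /jacobi_exp; case: (ltnP b r) => br.
  have -> : (b <= r)%N by lia.
  have -> : (r - b = (r - b.+1).+1)%N by lia.
  rewrite PnumS; nia.
case: (leqP b r) => br1.
  have -> : (r = b)%N by lia.
  by rewrite subnn subSnn QnumS Qnum0 Pnum0; lia.
have -> : (b.+1 - r = (b - r).+1)%N by lia.
rewrite QnumS; nia.
Qed.

(** The index k = r - b runs from -b to a, and [r + b] has its parity. Independent [a] and [b] let
    the product grow one factor at a time. *)
Definition jacobi_sum (a b : nat) : {poly int} :=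
  \sum_(0 <= r < (a + b).+1)
     (-1) ^+ (r + b) * ('X^(jacobi_exp m r b) * qbinom 'X^m (a + b) r).

(** Under [qbinomSr] one half of the coefficients rebuilds [jacobi_sum a b]; by [jacobi_expS] the
    other half is -X^(ma+1) times it. *)
Lemma jacobi_sumSl a b :
  jacobi_sum a.+1 b = jacobi_sum a b * (1 - 'X^(m * a + 1)).
Proof.
rewrite mulrBr mulr1 /jacobi_sum addSn [LHS]big_nat_recl // qbinom0.
pose F r : {poly int} :=
  (-1) ^+ (r + b) * ('X^(jacobi_exp m r b) * qbinom 'X^m (a + b) r).
pose G r : {poly int} := (-1) ^+ (r.+1 + b) *
  ('X^(jacobi_exp m r.+1 b) * ('X^m ^+ (a + b - r) * qbinom 'X^m (a + b) r)).
rewrite (eq_big_nat _ _ (F2 := fun r => F r.+1 + G r)); last first.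
  by move=> r /andP[_ lt_r]; rewrite qbinomSr // /F /G; ring.
rewrite big_split addrA /=; congr (_ + _).
  rewrite -[X in X + _](_ : F 0%N = _); last by rewrite /F qbinom0.
  rewrite -(big_nat_recl _ _ F) // big_nat_recr //=.
  by rewrite {2}/F qbinom_small ?mulr0 ?addr0.
rewrite mulr_suml -sumrN; apply: eq_big_nat => r /andP[_ lt_r].
rewrite /G addSn exprS -exprM.
have := @jacobi_expS r b a; rewrite addnC => /(_ lt_r) E.
rewrite [RHS](_ : _ = - (-1) ^+ (r + b) * qbinom 'X^m (a + b) r *
  ('X^(jacobi_exp m r b) * 'X^(m * a + 1))); last by ring.
by rewrite -exprD E !exprD; ring.
Qed.

(** Here the centre moves along with [b], so under [qbinomS] it is the shifted half [G] that
    rebuilds [jacobi_sum a b], by [jacobi_expSS]. *)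
Lemma jacobi_sumSr a b :
  jacobi_sum a b.+1 = jacobi_sum a b * (1 - 'X^(m * b + (m - 1))).
Proof.
rewrite mulrBr mulr1 /jacobi_sum addnS [LHS]big_nat_recl // qbinom0.
pose F r : {poly int} := (-1) ^+ (r + b.+1) *
  ('X^(jacobi_exp m r b.+1) * ('X^m ^+ r * qbinom 'X^m (a + b) r)).
pose G r : {poly int} :=
  (-1) ^+ (r + b) * ('X^(jacobi_exp m r b) * qbinom 'X^m (a + b) r).
rewrite (eq_big_nat _ _ (F2 := fun r => G r + F r.+1)); last first.
  move=> r /andP[_ lt_r]; rewrite qbinomS // /F /G jacobi_expSS addSn addnS.
  by rewrite !exprS; ring.
rewrite big_split addrCA /=; congr (_ + _).
rewrite -[X in X + _](_ : F 0%N = _); last by rewrite /F qbinom0 expr0 mulr1.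
rewrite -(big_nat_recl _ _ F) // big_nat_recr //=.
rewrite {2}/F qbinom_small ?mulr0 ?addr0 //.
rewrite mulr_suml -sumrN; apply: eq_big_nat => r /andP[_ lt_r].
rewrite /F addnS exprS -exprM.
have E := jacobi_expSr r b.
rewrite [RHS](_ : _ = - (-1) ^+ (r + b) * qbinom 'X^m (a + b) r *
  ('X^(jacobi_exp m r b) * 'X^(m * b + (m - 1)))); last by ring.
by rewrite -exprD E !exprD; ring.
Qed.

Lemma finite_jacobi N :
  \prod_(0 <= j < N) ((1 - 'X^(m * j + 1)) * (1 - 'X^(m * j + (m - 1))))
  = jacobi_sum N N.
Proof.
elim: N => [|N IHN].
  by rewrite big_nil /jacobi_sum big_nat1 /jacobi_exp /= Pnum0; ring.
by rewrite big_nat_recr // IHN jacobi_sumSl jacobi_sumSr /=; ring.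
Qed.

(** Every factor past the first [n] is 1 - X^d with d > n. *)
Lemma qfact_upto n a b : (n <= a)%N -> (n <= b)%N ->
  eq_upto n.+1 (qfact ('X^m : {poly int}) a) (qfact 'X^m b).
Proof.
suff H c : eq_upto n.+1 (qfact ('X^m : {poly int}) (n + c)) (qfact 'X^m n).
  move=> na nb; rewrite -(subnKC na) -(subnKC nb).
  by apply: eq_upto_trans (H _) (eq_upto_sym (H _)).
elim: c => [|c IHc]; first by rewrite addn0.
rewrite addnS qfactS -[qfact _ n]mulr1; apply: eq_upto_mul => // i lt_i.
rewrite coefB -exprM coefXn; case: eqP => [E|]; last by rewrite subr0.
by move: lt_i; rewrite E; nia.
Qed.

(* The condition on [u] says that [qfact 'X^m N] is invertible up to degree
   [n], so that it cancels. *)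
Lemma qbinom_upto n N r (u : {poly int}) : (n <= r)%N -> (n <= N)%N ->
  (r + n <= N + N)%N -> eq_upto n.+1 (u * qfact 'X^m N) 1 ->
  eq_upto n.+1 (qbinom ('X^m : {poly int}) (N + N) r * qfact 'X^m N) 1.
Proof.
move=> nr nN rn u1; have le_r : (r <= N + N)%N by lia.
have E := qbinom_fact ('X^m : {poly int}) le_r.
set c := qbinom _ _ _ in E *; set f := qfact _ N in u1 *.
(* [r], [N + N - r] and [N + N] are all at least [n], so each [qfact] in [E] agrees with [f] up to
   degree [n]. *)
have E1 : eq_upto n.+1 (c * f * f) f.
  apply: (@eq_upto_trans _ _ _ (qfact 'X^m (N + N))); last first.
    by apply: qfact_upto; lia.
  rewrite -E; apply: eq_upto_mul; last by apply: qfact_upto; lia.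
  by apply: eq_upto_mul => //; apply: qfact_upto; lia.
(* Multiplying [E1] by [u] cancels one [f], as u f is 1 up to degree [n]. *)
apply: eq_upto_trans (u1); apply: eq_upto_trans (eq_upto_mul _ E1) => //.
have -> : u * (c * f * f) = u * f * (c * f) by ring.
rewrite -[c * f in X in eq_upto _ X _]mul1r.
by apply: eq_upto_mul => //; apply: eq_upto_sym.
Qed.

End FiniteJacobi.

(** * Parts congruent to 0, 1 or -1 modulo [m] *)

Definition allowed (m x : nat) : bool :=
  ((x %% m == 0) || (x %% m == 1) || (x %% m == (m - 1) %% m))%N.

Lemma pprime_natE (m n : nat) : pprime_nat m n = part_count (allowed m) n.
Proof. by []. Qed.

(** Each block of [m] consecutive integers contains three allowed ones, distinct because m > 2. *)
Lemma prod_allowed (R : comNzRingType) (m N : nat) (F : nat -> R) : (2 < m)%N ->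
  \prod_(0 <= a < m * N | allowed m a.+1) F a.+1
  = \prod_(0 <= j < N)
      (F (m * j + 1)%N * F (m * j + (m - 1))%N * F (m * j.+1)%N).
Proof.
case: m => [|[|[|k]]] // _; set m := k.+3.
elim: N => [|N IHN]; first by rewrite muln0 !big_nil.
rewrite [RHS]big_nat_recr // -IHN (@big_cat_nat _ _ _ (m * N)) //=; last first.
  by rewrite leq_mul2l leqnSn orbT.
congr (_ * _); rewrite -{1}[(m * N)%N]add0n big_addn mulnS addnK.
(* The factor index is one less than the part, so the residues 1, m - 1, 0 occur at offsets 0, m -
   2, m - 1, where m = k + 3. *)
have allowedE c : (c < m)%N ->
    allowed m (c + m * N).+1 = [|| c == 0, c == k.+1 | c == k.+2]%N.
  move=> lt_c; rewrite /allowed -addSn addnC mulnC modnMDl subn1.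
  rewrite [(m.-1 %% m)%N]modn_small //.
  have [->|nc] := eqVneq c k.+2; first by rewrite modnn !orbT.
  have lt_c1 : (c.+1 < m)%N by lia.
  by rewrite modn_small //; lia.
rewrite big_mkcond big_nat_recl // !big_nat_recr //=.
rewrite big_nat big1 => [|c lt_c]; last first.
  by rewrite allowedE ?ifF //; lia.
rewrite !allowedE // !eqxx !orbT mul1r mulrA /m.
by congr (F _ * F _ * F _); lia.
Qed.

(** Splitting at the centre r = K: the terms below it, read backwards, give the [Qnum], those above
    it the [Pnum]. *)
Lemma jacobi_exp_sum (R : comNzRingType) (m K : nat) (T : nat -> R) :
  \sum_(0 <= r < (K + K).+1) (-1) ^+ (r + K) * T (jacobi_exp m r K)
  = T 0%N + \sum_(1 <= k < K.+1) (-1) ^+ k * (T (Pnum m k) + T (Qnum m k)).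
Proof.
rewrite (@big_cat_nat _ _ _ K) //=; last by lia.
rewrite [X in _ + X]big_ltn; last by lia.
have -> : jacobi_exp m K K = 0%N by rewrite /jacobi_exp leqnn subnn Pnum0.
rewrite -[(-1) ^+ (K + K)]signr_odd addnn odd_double mul1r -addnn.
rewrite addrCA; congr (_ + _); rewrite big_nat_rev addrC.
under [in RHS]eq_bigr do rewrite mulrDr.
rewrite big_split /=; congr (_ + _).
  rewrite -{1}[K.+1]add1n big_addn.
  have -> : ((K + K).+1 - K = K.+1)%N by lia.
  rewrite [LHS]big_nat [RHS]big_nat; apply: eq_bigr => k lt_k.
  rewrite /jacobi_exp leq_addl addnK; congr (_ * _).
  by rewrite -addnA -signr_odd -[RHS]signr_odd oddD addnn odd_double addbF.
rewrite big_add1 [LHS]big_nat [RHS]big_nat; apply: eq_bigr => k lt_k.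
rewrite /jacobi_exp ifF; last by lia.
congr (_ * T (Qnum m _)); last by lia.
by rewrite -signr_odd -[RHS]signr_odd; congr (_ ^+ _); lia.
Qed.

(* The series over k >= 1 converges to p'_m(n): its partial sums are
   eventually equal to p'_m(n). *)
Theorem theorem2p6 (m n : nat) (hm : (3 <= m)%N) (hn : (0 < n)%N) :
  exists N : nat, forall K : nat, (N <= K)%N ->
    ((pprime m n%:Z)%:R : int) =
    \sum_(1 <= k < K.+1)
      (-1) ^+ k.+1 * ((pprime m (n%:Z - (Pnum m k)%:Z))%:R
                      + (pprime m (n%:Z - (Qnum m k)%:Z))%:R).
Proof.
(* A term of degree at most [n] has |r - K| <= n; then K >= 2n gives n <= r <= 2K - n, as
   [qbinom_upto] requires. *)
exists (n + n)%N => K le_nK.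
pose G := part_gf n.+1 (fun x => allowed m x && (0 < x <= m * K)%N).
have m_gt1 : (1 < m)%N by lia.
have DG : eq_upto n.+1 (jacobi_sum m K K * qfact 'X^m K * G) 1.
  have := @part_gf_inv (allowed m) n.+1 (m * K); rewrite -/G.
  rewrite (prod_allowed _ (fun a => 1 - 'X^a : {poly int})) // big_split /=.
  rewrite (finite_jacobi m_gt1) /qfact.
  by under [in X in _ * X * _]eq_bigr do rewrite -exprM.
have thetaG : eq_upto n.+1
    ((\sum_(0 <= r < (K + K).+1) (-1) ^+ (r + K) * 'X^(jacobi_exp m r K))
     * G) 1.
  apply: eq_upto_trans (DG); apply: eq_upto_mul => //.
  rewrite /jacobi_sum mulr_suml; apply: eq_upto_sum => r.
  rewrite -!mulrA; apply: eq_upto_mul => //; apply: eq_upto_sym.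
  apply: eq_upto_XnM => lt_e; have := jacobi_exp_ge m_gt1 r K => ge_e.
  (* By [DG], [jacobi_sum m K K * G] inverts the [qfact] up to degree [n]. *)
  apply: (@qbinom_upto m m_gt1 n K r (jacobi_sum m K K * G)); try lia.
  by rewrite mulrAC.
have coefG e : ('X^e * G)`_n = (pprime m (n%:Z - e%:Z))%:R.
  rewrite coefXnM; case: ltnP => [lt_ne|le_en].
    by have -> : n%:Z - e%:Z = Negz (e - n).-1 by lia.
  rewrite subzn // coef_poly ltnS leq_subr /= pprime_natE; congr _%:R.
  (* The bound m K on the parts in [G] exceeds [n], so it excludes no partition counted here. *)
  apply: eq_part_count => x /andP[x0 le_x]; rewrite x0 andTb.
  suff -> : (x <= m * K)%N by rewrite andbT.
  nia.
(* Since n > 0, the coefficient of X^n in 1 is 0; the central term k = 0 of the series contributes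
   p'_m(n). *)
have := thetaG n (leqnn _); rewrite coef1 eqn0Ngt hn mulr_suml coef_sum.
rewrite (eq_bigr (fun r =>
  (-1) ^+ (r + K) * ('X^(jacobi_exp m r K) * G)`_n)); last first.
  move=> r _; rewrite -mulrA -signr_odd -[in RHS]signr_odd.
  by case: odd; rewrite ?mulN1r ?coefN ?mul1r.
rewrite (jacobi_exp_sum m K (fun e => ('X^e * G)`_n)) coefG subr0.
move/eqP; rewrite addr_eq0 => /eqP ->; rewrite -sumrN; apply: eq_bigr => k _.
by rewrite !coefG exprS; ring.
Qed.
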